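(* Let $n\ge 1$ be an integer, let $(\alpha,\beta)\subseteq\mathbb{R}$ be a bounded open interval and let $$P_{a(t)}(Z)=Z^n+\sum_{j=1}^n a_j(t)Z^{n-j},\quad t\in(\alpha,\beta),$$ be a monic polynomial with complex valued coefficients $a_j\in C^{n-1,1}([\alpha,\beta])$, $j=1,\ldots,n$. Let $1\le p<n/(n-1)$ and set $\gamma=1-1/p<1/n$. Then every continuous root $\lambda$ of $P_a$ on $(\alpha,\beta)$ (i.e., every continuous $\lambda:(\alpha,\beta)\to\mathbb{C}$ with $P_{a(t)}(\lambda(t))=0$ for all $t$) is Hölder continuous of exponent $\gamma$, and $$\|\lambda\|_{C^{0,\gamma}([\alpha,\beta])}\le C(n,p)\,\max\{1,(\beta-\alpha)^{1/p}\}\,\max_{1\le j\le n}\|a_j\|_{C^{n-1,1}([\alpha,\beta])}^{1/j},$$ where the constant $C(n,p)$ depends only on $n$ and $p$.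
   Context: For a bounded open interval $\Omega=(\alpha,\beta)$, $C^{k,\delta}([\alpha,\beta])$ is the space of complex valued $C^{k}$-functions on $\Omega$ whose derivatives of order $\le k$ extend continuously to $[\alpha,\beta]$ and whose $k$-th derivative is $\delta$-Hölder continuous. Its norm is $\|f\|_{C^{k,\delta}([\alpha,\beta])}=\sup_{0\le i\le k,\,t\in\Omega}|f^{(i)}(t)|+\sup_{x\ne y\in\Omega}|f^{(k)}(x)-f^{(k)}(y)|/|x-y|^\delta$. (For $p=1$, i.e. $\gamma=0$, the same formula is used.) Convention: $n/(n-1)=\infty$ if $n=1$. *)

(* Defs.v *)
From HB Require Import structures.
From mathcomp Require Import all_boot all_order all_algebra.
From mathcomp Require Import all_classical all_reals all_analysis.
From mathcomp Require Export complex.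

Set Implicit Arguments.
Unset Strict Implicit.
Unset Printing Implicit Defensive.
Import Order.TTheory GRing.Theory Num.Theory.
Import numFieldNormedType.Exports.
Local Open Scope classical_set_scope.
Local Open Scope ring_scope.

(* [Rcomplex R] is R[i] as a real vector space with the modulus as R-valued
   norm; these instances complete it to a [normedModType R], so that limits,
   derivatives ([derivable], [derive1n]) of functions R -> C are the library's. *)
Section Rcomplex_normedModType.
Variable R : realType.

HB.instance Definition _ := isPointed.Build (Rcomplex R) 0.
HB.instance Definition _ :=
  PseudoMetric.copy (Rcomplex R) (pseudoMetric_normed (Rcomplex R)).
HB.instance Definition _ := NormedZmod_PseudoMetric_eq.Build R (Rcomplex R) erefl.

Lemma Rcomplex_normrZ (k : R) (z : Rcomplex R) : `|k *: z| = `|k| * `|z|.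
Proof.
case: z => x y; rewrite -sqrtr_sqr -sqrtrM ?sqr_ge0//.
by congr Num.sqrt; rewrite !exprMn mulrDr.
Qed.

HB.instance Definition _ :=
  PseudoMetricNormedZmod_Lmodule_isNormedModule.Build R (Rcomplex R)
    Rcomplex_normrZ.

End Rcomplex_normedModType.

Definition holder_seminorm (R : realType) (alpha beta delta : R)
    (g : R -> Rcomplex R) : \bar R :=
  ereal_sup [set q | exists x y : R,
    [/\ x \in `]alpha, beta[, y \in `]alpha, beta[, x != y
      & q = (`|g x - g y| / `|x - y| `^ delta)%:E]].

(* Functions on the open interval are total functions R -> C, of which only the
   restriction to the interval matters.  For delta = 0 the last condition reads
   "bounded oscillation". *)
Definition in_CkHolder (R : realType) (k : nat) (delta alpha beta : R)
    (f : R -> Rcomplex R) : Prop :=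
  [/\ forall i, (i < k)%N ->
        {in `]alpha, beta[, forall t, derivable (derive1n i f) t 1},
      {in `]alpha, beta[, continuous (derive1n k f)},
      forall i, (i <= k)%N -> exists2 g : R -> Rcomplex R,
        {within `[alpha, beta], continuous g} &
        {in `]alpha, beta[, derive1n i f =1 g}
    & (holder_seminorm alpha beta delta (derive1n k f) < +oo)%E].

Definition CkHolder_norm (R : realType) (k : nat) (delta alpha beta : R)
    (f : R -> Rcomplex R) : \bar R :=
  (ereal_sup [set q | exists (i : nat) (t : R),
     [/\ (i <= k)%N, t \in `]alpha, beta[ & q = `|derive1n i f t|%:E]]
   + holder_seminorm alpha beta delta (derive1n k f))%E.

Definition monic_of_coefs (R : realType) (n : nat) (a : nat -> Rcomplex R) :
    {poly Rcomplex R} :=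
  'X^n + \sum_(1 <= j < n.+1) a j *: 'X^(n - j).

(* Main.v *)
(* The coefficients a_j are Lipschitz and lambda is bounded by n B, where
   B = max_j ||a_j||^(1/j).  Hence P_{a(s)} takes at lambda(t) a value of size
   O(B^n |t - s|), and as it is a product of n linear factors, lambda(t) lies
   within X = O(B |t - s|^(1/n)) of some root of P_{a(s)}.  A continuous curve
   that stays within X of a set of n points moves by at most 2 n X, so lambda is
   Hoelder continuous of exponent 1/n, which exceeds gamma = 1 - 1/p. *)

Require Import Defs.
From mathcomp Require Import all_boot all_order all_algebra.
From mathcomp Require Import all_classical all_reals all_analysis.
From mathcomp Require Import zify ring lra.

Import Order.TTheory GRing.Theory Num.Theory.
Import numFieldNormedType.Exports.
Local Open Scope classical_set_scope.
Local Open Scope ring_scope.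

Set Implicit Arguments.
Unset Strict Implicit.
Unset Printing Implicit Defensive.

(* The ascriptions to [Rcomplex R] select the R-valued modulus; without them
   products are inferred in R[i], whose norm is R[i]-valued. *)
Lemma RcomplexM_norm (R : realType) (x y : Rcomplex R) :
  `|x * y : Rcomplex R| = `|x| * `|y|.
Proof. exact: Normc.normcM. Qed.

Lemma RcomplexX_norm (R : realType) (x : Rcomplex R) (m : nat) :
  `|x ^+ m : Rcomplex R| = `|x| ^+ m.
Proof.
elim: m => [|m IHm]; first exact: Normc.normc1.
by rewrite !exprS RcomplexM_norm IHm.
Qed.

(** * Size, factorization and perturbation of the roots of a monic polynomial *)

Lemma horner_monic_of_coefs (R : realType) (n : nat) (a : nat -> Rcomplex R)
    (z : Rcomplex R) :
  (monic_of_coefs n a).[z] = z ^+ n + \sum_(1 <= j < n.+1) a j * z ^+ (n - j).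
Proof.
rewrite /monic_of_coefs hornerD hornerXn horner_sum; congr (_ + _).
by apply: eq_bigr => j _; rewrite hornerZ hornerXn.
Qed.

Lemma ler_norm_sum_coefs (R : realType) (n : nat) (d : nat -> Rcomplex R)
    (z : Rcomplex R) (M : R) :
  (forall j, (1 <= j <= n)%N -> `|d j| * `|z| ^+ (n - j) <= M) ->
  `|\sum_(1 <= j < n.+1) d j * z ^+ (n - j) : Rcomplex R| <= n%:R * M.
Proof.
move=> dM; apply: (le_trans (ler_norm_sum _ _ _)).
rewrite -[X in X%:R](card_ord n) mulr_natl -sumr_const big_add1 big_mkord /=.
by apply: ler_sum => i _; rewrite RcomplexM_norm RcomplexX_norm dM /=.
Qed.

(** When [B < |z|], the equation P(z) = 0 expresses z^n through n terms, each of modulus at most B^j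
    |z|^(n-j) <= B |z|^(n-1); cancelling |z|^(n-1) gives the bound. *)
Lemma root_monic_of_coefs_le (R : realType) (n : nat) (a : nat -> Rcomplex R)
    (z : Rcomplex R) (B : R) : (0 < n)%N -> 0 <= B ->
  (forall j, (1 <= j <= n)%N -> `|a j| <= B ^+ j) ->
  root (monic_of_coefs n a) z -> `|z| <= n%:R * B.
Proof.
move=> n0 B0 aB /rootP; rewrite horner_monic_of_coefs => /eqP.
rewrite addr_eq0 => /eqP zn.
have [zB|Bz] := leP `|z| B.
  by rewrite (le_trans zB)// ler_peMl// ler1n.
have z0 : 0 < `|z| by exact: le_lt_trans Bz.
suff : `|z| ^+ n <= n%:R * (B * `|z| ^+ n.-1).
  by rewrite -{1}(prednK n0) exprS mulrA ler_pM2r// exprn_gt0.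
rewrite -RcomplexX_norm zn normrN.
apply: ler_norm_sum_coefs => j jn; have /andP[j0 jlen] := jn.
apply: (@le_trans _ _ (B ^+ j * `|z| ^+ (n - j))).
  by rewrite ler_wpM2r ?exprn_ge0 ?aB.
rewrite -{1}(prednK j0) exprS -mulrA ler_wpM2l//.
apply: (@le_trans _ _ (`|z| ^+ j.-1 * `|z| ^+ (n - j))).
  by rewrite ler_wpM2r ?exprn_ge0// lerXn2r ?nnegrE // ltW.
by rewrite -exprD (_ : j.-1 + (n - j) = n.-1)%N//; lia.
Qed.

Lemma size_monic_of_coefs (R : realType) (n : nat) (a : nat -> Rcomplex R) :
  (0 < n)%N ->
  (size (\sum_(1 <= j < n.+1) a j *: 'X^(n - j))%R <
   size ('X^n : {poly Rcomplex R})%R)%N.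
Proof.
move=> n0; rewrite size_polyXn ltnS; apply/leq_sizeP => i ni.
rewrite coef_sum big_nat big1// => j /andP[j1 _].
rewrite coefZ coefXn; case: eqP => [ij|]; last by rewrite mulr0.
by move: ni; rewrite ij leqNgt ltn_subrL j1 n0.
Qed.

Lemma monic_of_coefs_factor (R : realType) (n : nat) (a : nat -> Rcomplex R) :
  (0 < n)%N -> exists2 r : seq (Rcomplex R), size r = n &
    monic_of_coefs n a = \prod_(c <- r) ('X - c%:P).
Proof.
move=> n0; have [r pE] := closed_field_poly_normal (monic_of_coefs n a).
have lead1 : lead_coef (monic_of_coefs n a) = 1.
  by rewrite /monic_of_coefs lead_coefDl ?lead_coefXn// size_monic_of_coefs.
exists r; last by rewrite [LHS]pE lead1 scale1r.
(* The number of factors is found by comparing sizes: a product of linear factors over [r] has size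
   [(size r).+1]. *)
apply/eqP; rewrite -eqSS; apply/eqP.
rewrite -(size_prod_XsubC r id).
move: pE; rewrite lead1 scale1r => <-.
by rewrite /monic_of_coefs size_polyDl ?size_monic_of_coefs// size_polyXn.
Qed.

(** If every element of [r] were farther than [X] from [z], each factor would exceed [X] and so the
    product would exceed X^(size r). Strictness requires at least one factor, since the empty
    product equals X^0. *)
Lemma small_value_near_root (R : realType) (r : seq (Rcomplex R))
    (z : Rcomplex R) (X : R) :
  (0 < size r)%N -> 0 <= X ->
  `|(\prod_(c <- r) ('X - c%:P)).[z] : Rcomplex R| <= X ^+ size r ->
  exists2 c, c \in r & `|z - c| <= X.
Proof.
move=> r0 X0 zX; apply: contrapT => far.
have {}far c : c \in r -> X < `|z - c|.
  by move=> cr; rewrite ltNge; apply/negP => zc; apply: far; exists c.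
suff : X ^+ size r < `|(\prod_(c <- r) ('X - c%:P)).[z] : Rcomplex R|.
  by move=> /(le_lt_trans zX); rewrite ltxx.
elim: r r0 far {zX} => // c [|d r] IH _ far.
  by rewrite big_seq1 hornerXsubC expr1 far// mem_head.
rewrite big_cons hornerM hornerXsubC RcomplexM_norm exprS.
apply: ltr_pM => //; first exact: exprn_ge0.
- by rewrite far// mem_head.
- by apply: IH => // e er; apply: far; rewrite inE er orbT.
Qed.

(** In the application [a] and [b] are the coefficients at two parameters and D^n is their distance.
    Subtracting P_a(z) = 0 from P_b(z) leaves only the differences of coefficients, against powers
    of z bounded by n B. *)
Lemma root_perturbation (R : realType) (n : nat) (a b : nat -> Rcomplex R)
    (z : Rcomplex R) (B D : R) : (0 < n)%N -> 0 <= B -> 0 <= D ->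
  (forall j, (1 <= j <= n)%N -> `|a j| <= B ^+ j) ->
  (forall j, (1 <= j <= n)%N -> `|a j - b j| <= 2 * B ^+ j * D ^+ n) ->
  root (monic_of_coefs n a) z ->
  `|(monic_of_coefs n b).[z] : Rcomplex R| <= (2 * n%:R ^+ 2 * B * D) ^+ n.
Proof.
move=> n0 B0 D0 aB abD za.
have zB := root_monic_of_coefs_le n0 B0 aB za.
have -> : (monic_of_coefs n b).[z] =
    - \sum_(1 <= j < n.+1) (a j - b j) * z ^+ (n - j).
  have /rootP := za; rewrite !horner_monic_of_coefs => /eqP.
  rewrite addr_eq0 => /eqP ->; rewrite -sumrN -sumrN -big_split/=.
  by apply: eq_bigr => j _; rewrite mulrBl opprB addrC.
rewrite normrN.
have nR : 1 <= n%:R :> R by rewrite ler1n.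
(* The factors n^(n-j) are enlarged to n^n to make the bound independent of j. *)
apply: (@le_trans _ _ (n%:R * (2 * n%:R ^+ n * (B * D) ^+ n))).
  apply: ler_norm_sum_coefs => j jn; have /andP[j0 jlen] := jn.
  apply: (@le_trans _ _ (2 * B ^+ j * D ^+ n * (n%:R * B) ^+ (n - j))).
    apply: ler_pM => //; rewrite ?exprn_ge0 ?abD//.
    by rewrite lerXn2r ?nnegrE// mulr_ge0.
  rewrite exprMn (_ : _ * (_ * _) =
    2 * n%:R ^+ (n - j) * (B ^+ j * B ^+ (n - j) * D ^+ n)); last by ring.
  rewrite -exprD subnKC// -exprMn ler_wpM2r ?exprn_ge0 ?mulr_ge0//.
  by rewrite ler_wpM2l// ler_weXn2l// leq_subr.
(* The leftover factor 2n is absorbed into the n-th power by 2n <= (2n)^n. *)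
rewrite (_ : n%:R * _ = (2 * n%:R) * (n%:R * (B * D)) ^+ n); last first.
  by rewrite [in RHS]exprMn; ring.
rewrite (_ : 2 * n%:R ^+ 2 * B * D = (2 * n%:R) * (n%:R * (B * D))); last by ring.
rewrite [leRHS]exprMn ler_wpM2r//.
  by rewrite exprn_ge0// !mulr_ge0.
by rewrite ler_eXnr//; lra.
Qed.

(* Otherwise pick size r + 1 points on the curve whose distances to f s are
   multiples of `|f t - f s| / size r > 2 X: no two are near the same element
   of r. *)
Lemma continuous_near_finite (R : realType) (f : R -> Rcomplex R)
    (r : seq (Rcomplex R)) (s t X : R) : s <= t -> 0 <= X ->
  {within `[s, t], continuous f} ->
  (forall u, u \in `[s, t] -> exists2 c, c \in r & `|f u - c| <= X) ->
  `|f t - f s| <= 2 * (size r)%:R * X.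
Proof.
move=> st X0 cf near_r; set L := `|f t - f s|; set m := size r.
have m0 : (0 < m)%N.
  have [|c] := near_r s; first by rewrite in_itv/= lexx.
  by rewrite /m; case: (r).
have m0R : 0 < m%:R :> R by rewrite ltr0n.
rewrite leNgt; apply/negP => LX.
have step : 2 * X < L / m%:R by rewrite ltr_pdivlMr// mulrAC.
pose v (k : 'I_m.+1) : R := k%:R * (L / m%:R).
have cphi : {within `[s, t], continuous (fun u => `|f u - f s|)}.
  move=> u; apply: (@cvg_norm _ _ _ (nbhs u)).
  by apply: cvgB; [exact: cf|exact: cvg_cst].
have /choice[c cP] (k : 'I_m.+1) : exists c : Rcomplex R,
    c \in r /\ exists2 u, `|f u - f s| = v k & `|f u - c| <= X.
  have [|u ust fu] := IVT (v := v k) st cphi.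
    rewrite subrr normr0 /Num.min /Num.max; case: ltgtP (normr_ge0 (f t - f s)) => //.
    - move=> L0 _; apply/andP; split; first by rewrite mulr_ge0// divr_ge0// ltW.
      rewrite /v mulrA ler_pdivrMr// mulrC ler_wpM2l//; first exact: ltW.
      by rewrite ler_nat -ltnS.
    - by move=> L0 _; rewrite /v /L -L0 mul0r mulr0 lexx.
  by have [d dr fd] := near_r u ust; exists d; split=> //; exists u.
have injc : injective c.
  move=> k l ckl; apply/eqP; rewrite eq_sym; apply: contraT => kl.
  have [_ [u fu uX]] := cP k; have [_ [w fw wX]] := cP l.
  have uw : `|v k - v l| <= 2 * X.
    rewrite -fu -fw; apply: (le_trans (ler_dist_dist _ _)).
    rewrite opprB addrA subrK (_ : f u - f w = (f u - c k) - (f w - c l)).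
      by rewrite (le_trans (ler_normB _ _))// mulrDl mul1r lerD.
    by rewrite ckl opprB addrA subrK.
  have := le_lt_trans uw step; rewrite /v -mulrBl normrM [X in _ * X]ger0_norm; last first.
    by rewrite divr_ge0 ?normr_ge0 ?ler0n.
  (* Dividing by the positive spacing [L / m%:R] leaves |k - l| < 1, which forces the two indices to
     coincide. *)
  rewrite -subr_gt0 -[X in 0 < X - _]mul1r -mulrBl pmulr_lgt0; last first.
    by apply: le_lt_trans step; rewrite mulr_ge0.
  rewrite subr_gt0 -[k%:R]/(k%:Z%:~R) -[l%:R]/(l%:Z%:~R) -intrB -intr_norm.
  rewrite (ltr_int R _ 1) => kl0; case/negP: kl; apply/eqP/val_inj => /=; lia.
have := uniq_leq_size (s1 := map c (enum 'I_m.+1)) (s2 := r).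
rewrite map_inj_uniq// enum_uniq size_map size_enum_ord => /(_ isT).
rewrite -/m ltnn => /(_ _)/negP[]//.
by move=> _ /mapP[k _ ->]; have [] := cP k.
Qed.

(** * Completeness of the complex plane and extension of Hölder functions to the closed interval *)

Lemma normRe_le (R : realType) (z : Rcomplex R) : `|complex.Re z| <= `|z|.
Proof.
case: z => x y /=; rewrite -[`|(_ : Rcomplex _)|]/(Num.sqrt (x ^+ 2 + y ^+ 2)).
by rewrite -sqrtr_sqr ler_sqrt ?addr_ge0 ?sqr_ge0// lerDl sqr_ge0.
Qed.

Lemma normIm_le (R : realType) (z : Rcomplex R) : `|complex.Im z| <= `|z|.
Proof.
case: z => x y /=; rewrite -[`|(_ : Rcomplex _)|]/(Num.sqrt (x ^+ 2 + y ^+ 2)).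
by rewrite -sqrtr_sqr ler_sqrt ?addr_ge0 ?sqr_ge0// lerDr sqr_ge0.
Qed.

Lemma le_normRcomplex (R : realType) (z : Rcomplex R) :
  `|z| <= `|complex.Re z| + `|complex.Im z|.
Proof.
case: z => x y /=; rewrite -[`|(_ : Rcomplex _)|]/(Num.sqrt (x ^+ 2 + y ^+ 2)).
rewrite -[leRHS]ger0_norm ?addr_ge0// -sqrtr_sqr ler_sqrt ?sqr_ge0//.
by rewrite sqrrD !real_normK ?num_real// addrAC lerDl mulrn_wge0// mulr_ge0.
Qed.

(** Real and imaginary parts do not increase the modulus, so they inherit the Cauchy condition and
    converge by completeness of the reals; their limits are then recombined. *)
Lemma Rcomplex_cauchy_cvg (R : realType) (F : set_system R) (FF : ProperFilter F)
    (f : R -> Rcomplex R) :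
  (forall e, 0 < e -> exists2 A : set R, F A &
     forall x y, A x -> A y -> `|f x - f y| < e) ->
  exists l : Rcomplex R, f @ F --> l.
Proof.
move=> cf.
have cvg_part (h : {linear Rcomplex R -> R}) : (forall z, `|h z| <= `|z|) ->
    cvg ((h \o f) @ F).
  move=> h1; apply/cauchy_cvgP/cauchy_ballP => e e0; have [A FA Af] := cf e e0.
  exists (((h \o f) @` A), ((h \o f) @` A)) => /=.
    suff : F ((h \o f) @^-1` ((h \o f) @` A)) by [].
    by apply: filterS FA => x Ax; exists x.
  move=> [_ _] [/= [x Ax <-] [y Ay <-]]; rewrite /ball/= -linearB.
  exact: le_lt_trans (h1 _) (Af _ _ Ax Ay).
have /cvg_ex[x fx] := cvg_part _ (@normRe_le R).
have /cvg_ex[y fy] := cvg_part _ (@normIm_le R).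
exists (complex.Complex x y); apply/cvgrPdist_lt => e e0.
have e20 : 0 < e / 2 by rewrite divr_gt0.
move/cvgrPdist_lt : fx => /(_ _ e20).
move/cvgrPdist_lt : fy => /(_ _ e20).
apply: filterS2 => u /= ye xe; rewrite [e]splitr.
apply: (le_lt_trans (le_normRcomplex _)).
by rewrite addrC ltrD// raddfB.
Qed.

(** Hölder continuity implies uniform continuity, so the Cauchy criterion yields one-sided limits at
    both endpoints, and these are the values of the extension there. *)
Lemma holder_extension (R : realType) (a b e K : R) (f : R -> Rcomplex R) :
  a < b -> 0 < e ->
  {in `]a, b[ &, forall x y, `|f x - f y| <= K * `|x - y| `^ e} ->
  exists2 g : R -> Rcomplex R, {within `[a, b], continuous g} &
    {in `]a, b[, f =1 g}.
Proof.
move=> ab e0 fK.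
have small eps : 0 < eps -> exists2 d, 0 < d &
    {in `]a, b[ &, forall x y, `|x - y| < d -> `|f x - f y| < eps}.
  move=> eps0.
  (* The modulus of continuity uses [|K|] because [K] may be negative. *)
  have : (`|K| * x `^ e) @[x --> 0^'+] --> `|K| * 0.
    by apply: cvgMr; exact: powR_cvg0.
  rewrite mulr0 => /cvgrPdist_lt/(_ _ eps0).
  rewrite near_withinE => /nbhs_ballP[d /= d0 dP].
  (* The limit at [0^'+] says nothing about the value at 0, so x = y is treated apart. *)
  exists d => // x y xab yab xyd; have [->|xy] := eqVneq x y.
    by rewrite subrr normr0.
  apply: (le_lt_trans (fK _ _ xab yab)).
  have := dP `|x - y|; rewrite /ball/= !sub0r !normrN normr_id => /(_ xyd).
  rewrite normr_gt0 subr_eq0 => /(_ xy).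
  apply: le_lt_trans; rewrite normrM normr_id [`|_ `^ _|]ger0_norm ?powR_ge0//.
  by rewrite ler_wpM2r ?powR_ge0// ler_norm.
have [la fa] : exists l : Rcomplex R, f @ a^'+ --> l.
  apply: Rcomplex_cauchy_cvg => eps /small[d d0 dP].
  exists [set x | a < x < Num.min b (a + d)].
    near=> x; apply/andP; split; near: x; first exact: nbhs_right_gt.
    by apply: nbhs_right_lt; rewrite lt_min ab ltrDl.
  move=> x y; rewrite /= !lt_min => /and3P[ax xb xd] /and3P[ay yb yd].
  by apply: dP; rewrite ?in_itv/= ?ax ?ay//; rewrite ltr_norml; lra.
have [lb fb] : exists l : Rcomplex R, f @ b^'- --> l.
  apply: Rcomplex_cauchy_cvg => eps /small[d d0 dP].
  exists [set x | Num.max a (b - d) < x < b].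
    near=> x; apply/andP; split; near: x; last exact: nbhs_left_lt.
    by apply: nbhs_left_gt; rewrite gt_max ab gtrBl.
  move=> x y; rewrite /= !gt_max => /andP[/andP[ax xd] xb] /andP[/andP[ay yd] yb].
  by apply: dP; rewrite ?in_itv/= ?ax ?ay//; rewrite ltr_norml; lra.
pose g x := if x <= a then la else if b <= x then lb else f x.
have fg : {in `]a, b[, f =1 g}.
  by move=> x; rewrite in_itv/= => /andP[ax xb]; rewrite /g leNgt ax/= leNgt xb.
have nearI x : x \in `]a, b[ -> \forall y \near x, y \in `]a, b[.
  exact: near_in_itvoo.
exists g => //; apply/continuous_within_itvP => //; split.
- move=> x xab; rewrite /continuous_at -fg//.
  have cfx : f @ x --> f x.
    apply/cvgrPdist_lt => eps /small[d d0 dP].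
    apply: filterS2 (nearI x xab) (nbhsx_ballx x d d0) => y yab xyd.
    exact: dP.
  apply: cvg_trans cfx; apply: near_eq_cvg.
  by apply: filterS (nearI x xab) => y /fg.
- rewrite {2}/g lexx; apply: cvg_trans fa; apply: near_eq_cvg; near=> y.
  apply: fg; rewrite in_itv/=; apply/andP; split; near: y.
    exact: nbhs_right_gt.
  exact: nbhs_right_lt.
- rewrite {2}/g leNgt ab/= lexx; apply: cvg_trans fb; apply: near_eq_cvg; near=> y.
  apply: fg; rewrite in_itv/=; apply/andP; split; near: y.
    exact: nbhs_left_gt.
  exact: nbhs_left_lt.
Unshelve. all: by end_near. Qed.

(** * Lipschitz bounds from bounds on the derivative *)

(** By linearity [h] maps difference quotients to difference quotients, and being 1-Lipschitz it
    preserves their limit. It serves for [h] the real or imaginary part. *)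
Lemma is_derive_comp_linear (R : realType) (h : {linear Rcomplex R -> R})
    (f : R -> Rcomplex R) (x : R) : (forall z, `|h z| <= `|z|) ->
  derivable f x 1 -> is_derive x 1 (h \o f) (h (derive1 f x)).
Proof.
move=> h1 df.
have : (h \o (fun d => d^-1 *: ((f \o shift x) (d *: 1) - f x))) @ 0^' -->
    h (derive1 f x).
  rewrite derive1E; apply/cvgrPdist_lt => e e0.
  move/cvgrPdist_lt : (df : _ --> 'D_1 f x) => /(_ _ e0).
  by apply: filterS => d /=; rewrite -linearB; exact: le_lt_trans.
have -> : h \o (fun d => d^-1 *: ((f \o shift x) (d *: 1) - f x)) =
    (fun d => d^-1 *: (((h \o f) \o shift x) (d *: 1) - (h \o f) x)).
  by apply/funext => d /=; rewrite linearZ linearB.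
move=> hd; apply: DeriveDef; first by apply/cvg_ex; eexists; exact: hd.
exact: cvg_lim hd.
Qed.

(** The mean value theorem holds for real valued functions only, so it is applied to the real and
    imaginary parts separately; adding the two estimates produces the factor 2. *)
Lemma derive1_bound_lipschitz (R : realType) (a b M : R) (f : R -> Rcomplex R) :
  {in `]a, b[, forall x, derivable f x 1} ->
  {in `]a, b[, forall x, `|derive1 f x| <= M} ->
  {in `]a, b[ &, forall x y, `|f x - f y| <= 2 * M * `|x - y|}.
Proof.
move=> df dM x y.
wlog xy : x y / y <= x.
  move=> H xab yab; have [/H|/ltW/H] := leP y x; first exact.
  by rewrite distrC (distrC x); exact.
move=> xab yab.
have sub u : u \in `[y, x] -> u \in `]a, b[.
  move: xab yab; rewrite !in_itv/= => /andP[_ xb] /andP[ay _] /andP[yu ux].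
  by rewrite (lt_le_trans ay)// (le_lt_trans ux).
have part (h : {linear Rcomplex R -> R}) : (forall z, `|h z| <= `|z|) ->
    `|h (f x - f y)| <= M * `|x - y|.
  move=> h1.
  have dhf u : u \in `[y, x] -> is_derive u 1 (h \o f) (h (derive1 f u)).
    by move=> /sub uab; apply: is_derive_comp_linear => //; exact: df.
  have chf : {within `[y, x], continuous (h \o f)}.
    by apply: derivable_within_continuous => u /dhf[].
  have dhf' u : u \in `]y, x[ -> is_derive u 1 (h \o f) (h (derive1 f u)).
    by move=> /subset_itv_oo_cc/dhf.
  have [u uyx /= hE] := MVT_segment xy dhf' chf.
  rewrite linearB hE normrM ler_wpM2r//.
  by rewrite (le_trans (h1 _))// dM// sub.
apply: (le_trans (le_normRcomplex _)).
have := part _ (@normRe_le R); have := part _ (@normIm_le R).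
by move=> /= ? ?; lra.
Qed.

(** * The Hölder seminorm and the norm of C^(k,d) *)

Lemma holder_seminorm_ge0 (R : realType) (a b d : R) (f : R -> Rcomplex R) :
  a < b -> (0 <= holder_seminorm a b d f)%E.
Proof.
move=> ab.
(* The supremum of the empty set is [-oo], so a pair of distinct points is exhibited. *)
pose x := (2 * a + b) / 3; pose y := (a + 2 * b) / 3.
apply: (@le_trans _ _ (`|f x - f y| / `|x - y| `^ d)%:E).
  by rewrite lee_fin divr_ge0// powR_ge0.
apply: ereal_sup_ubound; exists x, y; rewrite !in_itv/= /x /y; split => //; lra.
Qed.

Lemma holder_seminorm_le (R : realType) (a b d M : R) (f : R -> Rcomplex R) :
  (holder_seminorm a b d f <= M%:E)%E <->
  {in `]a, b[ &, forall x y, x != y -> `|f x - f y| <= M * `|x - y| `^ d}.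
Proof.
split=> [fM x y xab yab xy|fM].
  rewrite -ler_pdivrMr; last by rewrite powR_gt0// normr_gt0 subr_eq0.
  rewrite -lee_fin; apply: le_trans fM; apply: ereal_sup_ubound.
  by exists x, y.
apply: ge_ereal_sup => _ [x [y [xab yab xy ->]]].
rewrite lee_fin ler_pdivrMr; first exact: fM.
by rewrite powR_gt0// normr_gt0 subr_eq0.
Qed.

Lemma CkHolder_norm_ge (R : realType) (k : nat) (d a b : R)
    (f : R -> Rcomplex R) : a < b ->
  (forall i t, (i <= k)%N -> t \in `]a, b[ ->
     (`|derive1n i f t|%:E <= CkHolder_norm k d a b f)%E) /\
  (holder_seminorm a b d (derive1n k f) <= CkHolder_norm k d a b f)%E.
Proof.
move=> ab; rewrite /CkHolder_norm; set S := ereal_sup _.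
have S_ge i t : (i <= k)%N -> t \in `]a, b[ -> (`|derive1n i f t|%:E <= S)%E.
  by move=> ik tab; apply: ereal_sup_ubound; exists i, t.
split=> [i t ik tab|].
  apply: (le_trans (S_ge i t ik tab)).
  by apply: leeDl; exact: holder_seminorm_ge0.
(* The supremum [S] is nonnegative because it dominates |f| at the midpoint. *)
apply: leeDr; apply: (le_trans _ (S_ge 0%N ((a + b) / 2) _ _)) => //.
by rewrite in_itv/=; lra.
Qed.

Lemma CkHolder_norm_ge0 (R : realType) (k : nat) (d a b : R)
    (f : R -> Rcomplex R) : a < b -> (0 <= CkHolder_norm k d a b f)%E.
Proof.
move=> ab; apply: le_trans (CkHolder_norm_ge k d f ab).2.
exact: holder_seminorm_ge0.
Qed.

(** Each derivative up to order k agrees on the open interval with a continuous function on a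
    compact one, hence is bounded; the seminorm is finite by assumption. *)
Lemma CkHolder_norm_fin_num (R : realType) (k : nat) (d a b : R)
    (f : R -> Rcomplex R) : a < b -> in_CkHolder k d a b f ->
  CkHolder_norm k d a b f \is a fin_num.
Proof.
move=> ab [_ _ ext hf].
have /choice[M MP] (i : nat) : exists M : R, (i <= k)%N ->
    {in `]a, b[, forall t, `|derive1n i f t| <= M}.
  have [ik|] := boolP (i <= k)%N; last by exists 0.
  have [g cg fg] := ext i ik.
  have /compact_bounded/pinfty_ex_gt0[M _ gM] :=
    continuous_compact cg (@segment_compact _ a b).
  exists M => _ t tab; rewrite fg//; apply: gM; exists t => //=.
  exact: subset_itv_oo_cc tab.
rewrite ge0_fin_numE ?CkHolder_norm_ge0// lte_add_pinfty//.
(* The sum of the k + 1 individual bounds serves as a common bound. *)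
apply: (@le_lt_trans _ _ (\sum_(i < k.+1) `|M i|)%:E); last exact: ltry.
apply: ge_ereal_sup => _ [i [t [ik tab ->]]]; rewrite lee_fin.
rewrite (bigD1 (Ordinal (ik : (i < k.+1)%N)))//= ler_wpDr ?sumr_ge0//.
exact: le_trans (MP i ik t tab) (ler_norm _).
Qed.

Lemma CkHolder_lipschitz (R : realType) (k : nat) (a b M : R)
    (f : R -> Rcomplex R) : a < b -> in_CkHolder k 1 a b f ->
  (CkHolder_norm k 1 a b f <= M%:E)%E ->
  {in `]a, b[ &, forall x y, `|f x - f y| <= 2 * M * `|x - y|}.
Proof.
move=> ab [df _ _ _] fM; have [df_le hf_le] := CkHolder_norm_ge k 1 f ab.
have dM i t : (i <= k)%N -> t \in `]a, b[ -> `|derive1n i f t| <= M.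
  by move=> ik tab; rewrite -lee_fin (le_trans (df_le i t ik tab)).
have {df_le hf_le}hM := le_trans hf_le fM.
(* For k = 0 the seminorm is itself the Lipschitz constant; otherwise the norm controls the first
   derivative. *)
case: k df fM dM hM => [|k] df fM dM hM.
  move=> x y xab yab; have [->|xy] := eqVneq x y.
    by rewrite !subrr !normr0 mulr0.
  move/holder_seminorm_le : hM => /(_ x y xab yab xy).
  rewrite derive1n0 powRr1// => /le_trans; apply; rewrite ler_wpM2r//.
  have := le_trans (normr_ge0 _) (dM 0%N x (leqnn _) xab); lra.
apply: derive1_bound_lipschitz => x xab; first exact: (df 0%N).
by have := dM 1%N x isT xab; rewrite derive1n1.
Qed.

(** * Hölder continuity of a root and the final estimate *)

Lemma root_holder (R : realType) (n : nat) (alpha beta B : R)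
    (a : nat -> R -> Rcomplex R) (lambda : R -> Rcomplex R) :
  (0 < n)%N -> 0 <= B ->
  (forall j t, (1 <= j <= n)%N -> t \in `]alpha, beta[ -> `|a j t| <= B ^+ j) ->
  (forall j, (1 <= j <= n)%N -> {in `]alpha, beta[ &, forall x y,
     `|a j x - a j y| <= 2 * B ^+ j * `|x - y|}) ->
  {in `]alpha, beta[, continuous lambda} ->
  (forall t, t \in `]alpha, beta[ ->
     root (monic_of_coefs n (fun j => a j t)) (lambda t)) ->
  {in `]alpha, beta[ &, forall x y,
     `|lambda x - lambda y| <= 4 * n%:R ^+ 3 * B * `|x - y| `^ n%:R^-1}.
Proof.
move=> n0 B0 aB aL cl rootl x y.
wlog xy : x y / y <= x.
  move=> H xab yab; have [/H|/ltW/H] := leP y x; first exact.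
  by rewrite distrC (distrC x); exact.
move=> xab yab.
have sub u : u \in `[y, x] -> u \in `]alpha, beta[.
  move: xab yab; rewrite !in_itv/= => /andP[_ xb] /andP[ay _] /andP[yu ux].
  by rewrite (lt_le_trans ay)// (le_lt_trans ux).
set D := `|x - y| `^ n%:R^-1.
have D0 : 0 <= D by exact: powR_ge0.
have Dn : D ^+ n = `|x - y|.
  by rewrite -powR_mulrn// -powRrM mulVf ?powRr1// pnatr_eq0 -lt0n.
have [r rn yE] := monic_of_coefs_factor (fun j => a j y) n0.
have X0 : 0 <= 2 * n%:R ^+ 2 * B * D by rewrite !mulr_ge0.
(* The constant 4 n^3 is 2n, from a curve near n points, times 2 n^2, from the perturbation
   bound. *)
rewrite (_ : _ * D = 2 * (size r)%:R * (2 * n%:R ^+ 2 * B * D)); last by rewrite rn; ring.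
apply: continuous_near_finite => //.
  by apply: continuous_in_subspaceT => u; rewrite inE/= => /sub/cl.
move=> u uyx; have uab := sub u uyx.
apply: small_value_near_root => //; first by rewrite rn.
rewrite rn -yE; apply: (@root_perturbation _ _ (fun j => a j u)) => //.
- by move=> j jn; exact: aB.
- move=> j jn; apply: (le_trans (aL j jn u y uab yab)).
  (* As u lies between y and x, |u - y| <= |x - y|, so the same [D] works along the whole
     segment. *)
  rewrite Dn ler_wpM2l// ?mulr_ge0 ?exprn_ge0//.
  move: uyx; rewrite in_itv/= => /andP[yu ux].
  by rewrite !ger0_norm ?subr_ge0// lerB.
- exact: rootl.
Qed.

(** This lowers the Hölder exponent from [r] to [g]: the excess factor D^(r-g) is at most 1 if D <=
    1, and at most D^q <= L^q otherwise. *)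
Lemma powR_le_max (R : realType) (D L r g q : R) :
  0 < D -> D <= L -> g <= r -> r - g <= q ->
  D `^ r <= Num.max 1 (L `^ q) * D `^ g.
Proof.
move=> D0 DL gr rq; have DN0 : D != 0 by rewrite gt_eqF.
rewrite -(subrK g r) powRD; last by rewrite DN0 implybT.
rewrite ler_wpM2r ?powR_ge0// le_max.
have [D1|D1] := leP D 1.
  by rewrite -[X in _ <= X](powRr0 D) ger_powR ?D0 ?D1// subr_ge0.
apply/orP; right; apply: (@le_trans _ _ (D `^ q)).
  by rewrite ler_powR// ltW.
rewrite ge0_ler_powR ?nnegrE ?(ltW D0)//; first by rewrite (le_trans _ rq)// subr_ge0.
exact: le_trans (ltW D0) DL.
Qed.

(** [B] is the real number behind the extended real maximum on the right of the final estimate;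
    raising N_j^(1/j) <= B to the power j bounds the norms themselves. *)
Lemma bigmax_coefs_fine (R : realType) (n : nat) (N : nat -> \bar R) :
  (forall j, (1 <= j <= n)%N -> N j \is a fin_num) ->
  (forall j, (1 <= j <= n)%N -> (0 <= N j)%E) ->
  exists2 B : R, 0 <= B &
    (\big[maxe/0]_(1 <= j < n.+1) poweR (N j) (j%:R^-1))%E = B%:E /\
    forall j, (1 <= j <= n)%N -> (N j <= (B ^+ j)%:E)%E.
Proof.
move=> Nfin N0; set S := (\big[maxe/0]_(1 <= j < n.+1) _)%E.
have S0 : (0 <= S)%E by apply: bigmax_ge_id.
have Sfin : S \is a fin_num.
  rewrite ge0_fin_numE// /S big_nat_cond; elim/big_ind: _ => //.
    by move=> x y xy yy; rewrite gt_max xy yy.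
  move=> j /andP[jn _]; rewrite ltey_eq fin_num_poweR// Nfin//.
exists (fine S); first exact: fine_ge0.
split=> [|j jn]; first by rewrite fineK.
have j0 : j%:R != 0 :> R by rewrite pnatr_eq0 -lt0n; case/andP: jn.
have NS : fine (N j) `^ j%:R^-1 <= fine S.
  rewrite -lee_fin fineK// -poweR_EFin fineK ?Nfin//.
  apply: (le_bigmax_seq _ _ xpredT (fun j => poweR (N j) (j%:R^-1))) => //.
  by rewrite mem_index_iota.
rewrite -(fineK (Nfin j jn)) lee_fin.
have Nj0 : 0 <= fine (N j) by rewrite fine_ge0// N0.
rewrite -[leLHS](powRr1 Nj0) -(mulVf j0) powRrM powR_mulrn ?powR_ge0//.
by rewrite lerXn2r ?nnegrE ?powR_ge0 ?fine_ge0.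
Qed.

Theorem corollary1 (R : realType) (n : nat) (p : R)
    (hn : (1 <= n)%N) (hp1 : 1 <= p)
    (hpn : (1 < n)%N -> p < n%:R / (n%:R - 1)) :
  exists C : R, forall (alpha beta : R) (a : nat -> R -> Rcomplex R)
      (lambda : R -> Rcomplex R),
    alpha < beta ->
    (forall j : nat, (1 <= j <= n)%N ->
       in_CkHolder n.-1 1 alpha beta (a j)) ->
    {in `]alpha, beta[, continuous lambda} ->
    (forall t : R, t \in `]alpha, beta[ ->
       root (monic_of_coefs n (fun j => a j t)) (lambda t)) ->
    in_CkHolder 0 (1 - p^-1) alpha beta lambda /\
    (CkHolder_norm 0 (1 - p^-1) alpha beta lambda <=
       (C * Num.max 1 ((beta - alpha) `^ p^-1))%:E *
       \big[maxe/0]_(1 <= j < n.+1)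
          poweR (CkHolder_norm n.-1 1 alpha beta (a j)) (j%:R^-1))%E.
Proof.
have n1 : 1 <= n%:R :> R by rewrite ler1n.
have p0 : 0 < p by rewrite (lt_le_trans _ hp1).
have pV1 : p^-1 <= 1 by rewrite invf_le1.
have gn : 1 - p^-1 < n%:R^-1.
  (* For n = 1 the bound n/(n-1) is infinite and the claim reduces to 1/p > 0; for n > 1 it is the
     inverted form of p < n/(n-1). *)
  have [n2|] := ltnP 1 n; last first.
    move=> nle; have -> : n = 1%N by apply/eqP; rewrite eqn_leq nle hn.
    by rewrite invr1 ltrBlDr ltrDl invr_gt0.
  have n10 : 0 < n%:R - 1 :> R by rewrite subr_gt0 ltr1n.
  rewrite ltrBlDr -ltrBlDl.
  rewrite -[X in X - _](@mulfV _ n%:R) ?gt_eqF ?(lt_le_trans _ n1)//.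
  rewrite -[X in _ - X]mul1r -mulrBl -ltf_pV2 ?posrE ?invr_gt0 ?divr_gt0//; last first.
    exact: lt_le_trans n1.
  by rewrite invrK invf_div; exact: hpn.
(* The summand n comes from |lambda| <= n B, and 4 n^3 from the Hölder seminorm. *)
exists (n%:R + 4 * n%:R ^+ 3) => alpha beta a lambda ab ha cl rootl.
have jfin j : (1 <= j <= n)%N -> CkHolder_norm n.-1 1 alpha beta (a j) \is a fin_num.
  by move=> /ha; exact: CkHolder_norm_fin_num.
have [j _|B B0 [-> NB]] := bigmax_coefs_fine jfin; first exact: CkHolder_norm_ge0.
have aB j t : (1 <= j <= n)%N -> t \in `]alpha, beta[ -> `|a j t| <= B ^+ j.
  move=> jn tab; rewrite -lee_fin; apply: le_trans (NB j jn).
  exact: (CkHolder_norm_ge n.-1 1 (a j) ab).1 0%N t isT tab.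
have aL j (jn : (1 <= j <= n)%N) := CkHolder_lipschitz ab (ha j jn) (NB j jn).
have holder := root_holder hn B0 aB aL cl rootl.
have bound t : t \in `]alpha, beta[ -> `|lambda t| <= n%:R * B.
  by move=> tab; apply: root_monic_of_coefs_le (rootl t tab) => // j jn; exact: aB.
set m := Num.max 1 _.
have m1 : 1 <= m by rewrite le_max lexx.
have semi : (holder_seminorm alpha beta (1 - p^-1) lambda <=
    (4 * n%:R ^+ 3 * B * m)%:E)%E.
  apply/holder_seminorm_le => x y xab yab xy; apply: (le_trans (holder x y xab yab)).
  rewrite -[leRHS]mulrA ler_wpM2l ?mulr_ge0 ?exprn_ge0//.
  apply: powR_le_max; [by rewrite normr_gt0 subr_eq0| |exact: ltW|].
    by move: xab yab; rewrite !in_itv/= ler_norml => /andP[? ?] /andP[? ?]; lra.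
  (* The gap 1/n - (1 - 1/p) is at most 1/p because 1/n <= 1. *)
  rewrite opprB addrCA gerDl subr_le0 invf_le1//; exact: lt_le_trans n1.
split.
  split => //; last by rewrite derive1n0 (le_lt_trans semi)// ltry.
  move=> i; rewrite leqn0 => /eqP ->; rewrite derive1n0.
  (* The exponent here is 1/n, which is positive, whereas 1 - 1/p vanishes for p = 1. *)
  by apply: holder_extension holder => //; rewrite invr_gt0 (lt_le_trans _ n1).
rewrite /CkHolder_norm derive1n0 -EFinM.
apply: (@le_trans _ _ ((n%:R * B)%:E + (4 * n%:R ^+ 3 * B * m)%:E)%E).
  apply: leeD => //; apply: ge_ereal_sup => _ [i [t [+ tab ->]]].
  by rewrite leqn0 => /eqP ->; rewrite lee_fin; exact: bound.
rewrite -EFinD lee_fin.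
(* The supremum bound lacks the factor [m], which can be inserted since m >= 1. *)
have : n%:R * B <= n%:R * B * m by rewrite ler_peMr ?mulr_ge0.
by move=> h; rewrite (_ : _ * m * B = n%:R * B * m + 4 * n%:R ^+ 3 * B * m) ?lerD2r//; ring.
Qed.
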